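(* Let $k\ge 3$ and $t\ge 2$ be integers. Let $U_t(A,B)$ denote the number of solutions of $$\sum_{j=1}^t a_j(x_j^k-y_j^k)=0$$ in integers $a_j,x_j,y_j$ $(1\le j\le t)$ satisfying $0<|a_j|\le A$, $|x_j|\le B$, $|y_j|\le B$. Then, for real numbers $A,B$ with $A\ge 2B^k\ge 1$ and every $\varepsilon>0$, one has $$U_t(A,B)\ll (AB)^t+A^{t-1}B^{2t-k+\varepsilon}.$$
   Context: The implicit constant depends only on $k,t,\varepsilon$. *)

(* Defs.v *)
From mathcomp Require Import all_boot all_order all_algebra finmap.
From mathcomp Require Import zify.
From mathcomp Require Import all_classical all_reals all_analysis.

Set Implicit Arguments.
Unset Strict Implicit.
Unset Printing Implicit Defensive.

Import Order.TTheory GRing.Theory Num.Theory.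

Local Open Scope classical_set_scope.
Local Open Scope ring_scope.

Definition is_solution (R : realType) (k t : nat) (A B : R)
    (a x y : {ffun 'I_t -> int}) : Prop :=
  (forall j, [/\ 0 < `|a j|, `|a j|%:~R <= A,
                 `|x j|%:~R <= B & `|y j|%:~R <= B]) /\
  \sum_(j < t) a j * (x j ^+ k - y j ^+ k) = 0.

Definition solutions (R : realType) (k t : nat) (A B : R) :
    set ({ffun 'I_t -> int} * {ffun 'I_t -> int} * {ffun 'I_t -> int}) :=
  [set s | is_solution k A B s.1.1 s.1.2 s.2].
Arguments solutions {R} k t A B.

(* [fset_set] sends infinite sets to the empty one; [finite_solutions] below
   shows that this does not happen here. *)
Definition U (R : realType) (k t : nat) (A B : R) : nat :=
  #|` fset_set (solutions k t A B)|.

Lemma finite_int_box (R : realType) (t : nat) (M : R) :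
  finite_set [set f : {ffun 'I_t -> int} | forall j, `|f j|%:~R <= M].
Proof.
pose N := Num.truncn `|M|.
pose g (h : {ffun 'I_t -> 'I_(N + N).+1}) : {ffun 'I_t -> int} :=
  [ffun j => (h j)%:Z - N%:Z].
apply: (@sub_finite_set _ _ (g @` setT)); last first.
  exact/finite_image/finite_finset.
move=> f /= fM.
have fN j : (`|f j| <= N)%N.
  rewrite /N truncn_ge_nat ?normr_ge0//.
  by apply: le_trans (ler_norm M); have := fM j; rewrite -abszE.
exists [ffun j => inord (absz (f j + N%:Z))] => //.
apply/ffunP => j; rewrite !ffunE inordK; move: (fN j); move: (f j) (N) => z n; lia.
Qed.

Lemma finite_solutions (R : realType) (k t : nat) (A B : R) :
  finite_set (solutions k t A B).
Proof.
have finA := finite_int_box t A; have finB := finite_int_box t B.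
apply: sub_finite_set (finite_setX (finite_setX finA finB) finB).
by move=> [[a x] y] [H _]; split; [split|] => j; case: (H j).
Qed.

(* Main.v *)
Require Import Defs.
From mathcomp Require Import all_boot all_order all_algebra.
From mathcomp Require Import all_classical all_reals all_analysis.
From mathcomp Require Import finmap zify ring lra.

Set Implicit Arguments.
Unset Strict Implicit.
Unset Printing Implicit Defensive.

Import Order.TTheory GRing.Theory Num.Theory.

Local Open Scope ring_scope.

(* Write [d_j = x_j ^ k - y_j ^ k] and fix [x, y]. If all [d_j] vanish, the [a_j]
   are free, which contributes [(A B) ^ t]. Otherwise let [D > 0] be the largest
   [|d_j|] and [g] the gcd of the [d_j]; as [D <= 2 B ^ k <= A], the number of [a]
   orthogonal to [d] is [<< A ^ (t - 1) g / D].

   For [t <= k] the bound [g / D <= 1] suffices, because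
   [A ^ (t - 1) B ^ (2 t) <= A ^ (t - 1) B ^ (t + k) <= (A B) ^ t]. For [t > k],
   fix the pair where [D] is attained and a divisor [g] of [D]; every other pair
   satisfies [g | x ^ k - y ^ k] and [|x ^ k - y ^ k| <= D], which leaves
   [<< B ^ (1 + eps) (D / g) ^ (1 / k)] choices. Indeed, for [y <> 0] one takes out
   [e = gcd(x, y)], a divisor of [y]; the remaining congruence is modulo
   [g / gcd(g, e ^ k)] between coprime numbers, so it has [<< B ^ eps] solutions
   per period, and [|x|] is within [D ^ (1 / k)] of [|y|]. Since [t - 1 >= k],
   [(g / D) (D / g) ^ ((t - 1) / k) << B ^ (t - 1 - k)], and summing over the
   [<< B ^ eps] divisors [g] and the first pair gives [A ^ (t - 1) B ^ (2 t - k + eps)]. *)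

(** * The divisor function and roots of congruences *)

Lemma size_leq_fibres (S U : eqType) (f : S -> U) (r : seq U) (m : nat)
    (s : seq S) :
  {in s, forall x, f x \in r} ->
  (forall u, u \in r -> (size [seq x <- s | f x == u] <= m)%N) ->
  (size s <= size r * m)%N.
Proof.
elim: r s => [|u r IHr] s fr cnt.
  by case: s fr {cnt} => // x s /(_ x (mem_head _ _)).
rewrite /= mulSn -(count_predC [pred x | f x == u]) -!size_filter.
apply: leq_add; first exact/cnt/mem_head.
apply: IHr => [x|v vr].
  rewrite mem_filter /= => /andP[fxu /fr].
  by rewrite inE (negbTE fxu).
apply: leq_trans (cnt v _); last by rewrite inE vr orbT.
rewrite -filter_predI !size_filter; apply: sub_count => x /= /andP[].
by [].
Qed.

(** [divisors] folds over the prime decomposition; each of the [logn p n] merge steps for [p] adds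
    one more copy of the list as it was before [p]. *)
Lemma size_divisors (n : nat) :
  size (divisors n) = (\prod_(p <- primes n) (logn p n).+1)%N.
Proof.
rewrite /divisors prime_decompE.
elim: (primes n) => [|p ps IHp] /=; first by rewrite big_nil.
rewrite big_cons -IHp; set s := foldr _ _ _.
elim: (logn p n) => [|e IHe] /=; first by rewrite mul1n.
by rewrite size_merge size_cat size_map IHe mulSn addnC.
Qed.

Lemma leq_expn2r (m n e : nat) : (m <= n)%N -> (m ^ e <= n ^ e)%N.
Proof. by case: e => // e le_mn; rewrite leq_exp2r. Qed.

(** Handles the small primes in the divisor bound. With [q = a %/ m] one has
    [a + 1 <= m (q + 1) <= m 2 ^ q]; raise this to the power [m]. *)
Lemma expSn_leq_exp2 (m a : nat) : (a.+1 ^ m <= m ^ m * 2 ^ a)%N.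
Proof.
have [->|m_gt0] := posnP m; first by rewrite !expn0 mul1n expn_gt0.
have le1 : (a.+1 <= m * 2 ^ (a %/ m))%N.
  apply: leq_trans (_ : m * (a %/ m).+1 <= _)%N.
    by rewrite mulnC ltn_ceil.
  by rewrite leq_mul2l ltn_expl // orbT.

apply: leq_trans (_ : (m * 2 ^ (a %/ m)) ^ m <= _)%N; first exact: leq_expn2r.
by rewrite expnMn -expnM leq_mul2l leq_pexp2l ?leq_divM ?orbT.
Qed.

(** Compare both sides prime by prime. If [p >= 2 ^ m], then [(e + 1) ^ m <= 2 ^ (e m) <= p ^ e]. A
    prime below [2 ^ m] costs a factor [m ^ m], and there are at most [2 ^ m] of these, whence
    [K]. *)
Lemma divisor_bound (m : nat) :
  exists K : nat, forall n, (0 < n)%N -> (size (divisors n) ^ m <= K * n)%N.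
Proof.
pose c := (m ^ m)%N; exists (c ^ 2 ^ m)%N => n n_gt0.
have c_gt0 : (0 < c)%N by rewrite /c; case: (m) => // m'; rewrite expn_gt0.
have pr p : p \in primes n -> prime p by rewrite mem_primes => /and3P[].
have -> : (size (divisors n) ^ m
    = \prod_(p <- primes n) (logn p n).+1 ^ m)%N.
  rewrite size_divisors; elim: (primes n) => [|p ps IHp].
    by rewrite !big_nil exp1n.
  by rewrite !big_cons expnMn IHp.
apply: leq_trans (_ : \prod_(p <- primes n)
   ((if p < 2 ^ m then c else 1) * p ^ logn p n) <= _)%N.
  rewrite big_seq [leqRHS]big_seq; apply: leq_prod => p /pr p_pr.
  case: ltnP => [_|le2p].
    apply: leq_trans (expSn_leq_exp2 _ _) _.
    by rewrite leq_mul2l leq_expn2r ?prime_gt1 ?orbT.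
  rewrite mul1n; apply: leq_trans (_ : 2 ^ (logn p n * m) <= _)%N.
    by rewrite expnM leq_expn2r // ltn_expl.
  by rewrite mulnC expnM leq_expn2r.
rewrite big_split /= [X in (_ <= _ * X)%N](prod_prime_decomp n_gt0) prime_decompE big_map /=.
rewrite leq_mul2r -big_mkcond /=; apply/orP; right.
rewrite -big_filter big_const_seq count_predT iter_muln_1 leq_pexp2l //.
rewrite -[leqRHS](size_iota 0); apply: uniq_leq_size.
  by rewrite filter_uniq ?primes_uniq.
by move=> p; rewrite mem_filter mem_iota => /andP[].
Qed.

Lemma size_leq_inj (S U : eqType) (f : S -> U) (r : seq U) (s : seq S) :
  uniq s -> {in s &, injective f} -> {in s, forall x, f x \in r} ->
  (size s <= size r)%N.
Proof.
move=> us injf fr; rewrite -(size_map f); apply: uniq_leq_size.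
  by rewrite map_inj_in_uniq.
by move=> _ /mapP[x xs ->]; apply: fr.
Qed.

Lemma mem_iota_absz_modz (x : int) (n : nat) :
  (0 < n)%N -> `|(x %% n)%Z|%N \in iota 0 n.
Proof.
move=> n_gt0; have n0 : n%:Z != 0 by lia.
have := modz_ge0 x n0; have := @ltz_pmod x n%:Z; rewrite mem_iota; lia.
Qed.

Lemma absz_modz_inj (x y : int) (n : nat) : (0 < n)%N ->
  `|(x %% n)%Z|%N = `|(y %% n)%Z|%N -> (n %| x - y)%Z.
Proof.
move=> n_gt0; have n0 : n%:Z != 0 by lia.
have := modz_ge0 x n0; have := modz_ge0 y n0 => y0 x0 exy.
by rewrite -eqz_mod_dvd; apply/eqP; lia.
Qed.

Lemma dvdz_subX (x y : int) (n : nat) : (x - y %| x ^+ n - y ^+ n)%Z.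
Proof. by rewrite subrXX dvdz_mulr. Qed.

Lemma PoszX (p a : nat) : (p ^ a)%N%:Z = p%:Z ^+ a.
Proof. by rewrite -natz natrX natz. Qed.

(* If [p ^ (v + 1)] divides [x - y], where [v] is the valuation of [k], then
   [(x ^ k - y ^ k) / (x - y)] has valuation exactly [v]. *)
Lemma dvdz_sub_of_subX (k p a : nat) (x y : int) : (0 < k)%N -> prime p ->
  ~~ (p %| y)%Z -> ((p ^ (logn p k).+1)%N %| x - y)%Z ->
  ((p ^ a)%N %| x ^+ k - y ^+ k)%Z ->
  ((p ^ a)%N %| (p ^ logn p k)%N%:Z * (x - y))%Z.
Proof.
move=> k_gt0 p_pr py; set v := logn p k => pv pa.
have [k1 pk1 kE] := pfactor_coprime p_pr k_gt0; rewrite -/v in kE.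
have /dvdzP[q qE] := pv.
(* Modulo [x - y] every term of the sum is [y ^ (k - 1)]. *)
have [G GE] : exists G, \sum_(i < k) x ^+ (k.-1 - i) * y ^+ i
    = k%:Z * y ^+ k.-1 + (x - y) * G.
  have /dvdzP[G GE] : (x - y %| \sum_(i < k) x ^+ (k.-1 - i) * y ^+ i
      - \sum_(i < k) y ^+ k.-1)%Z.
    rewrite -sumrB; apply: rpred_sum => i _.
    have -> : y ^+ k.-1 = y ^+ (k.-1 - i) * y ^+ i.
      by rewrite -exprD subnK // -ltnS prednK.
    by rewrite -mulrBl dvdz_mulr // dvdz_subX.
  exists G; rewrite [RHS]addrC [(x - y) * G]mulrC -GE sumr_const card_ord.
  by rewrite -mulr_natl natz subrK.
move: pa; rewrite subrXX GE.
have -> : k%:Z * y ^+ k.-1 + (x - y) * G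
    = (p ^ v)%N%:Z * (k1%:Z * y ^+ k.-1 + p%:Z * (q * G)).
  by rewrite {1}kE qE !PoszM expnSr PoszM; ring.
(* [F1] is [k1 y ^ (k - 1)] plus a multiple of [p], and [p] divides neither [k1] nor [y]. *)
set F1 := (X in (x - y) * (_ * X)).
suff copF : coprimez (p ^ a)%N F1.
  by rewrite mulrA (Gauss_dvdzl _ copF) mulrC.
rewrite PoszX; apply: coprimezXl; rewrite /F1 coprimezE /= prime_coprime //.
apply/negP => pF; have : (p %| k1%:Z * y ^+ k.-1)%Z.
  by rewrite -(rpredDr _ (dvdz_mulr (q * G) (dvdzz p))).
rewrite dvdzE abszM abszX /= Euclid_dvdM // Euclid_dvdX // => /orP[|/andP[pdy _]].
  by apply/negP; rewrite -prime_coprime.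
by rewrite dvdzE /= pdy in py.
Qed.

Lemma size_roots_Fp (k p : nat) (y : int) (s : seq int) :
  (0 < k)%N -> prime p -> uniq s ->
  {in s, forall x, (p %| x ^+ k - y ^+ k)%Z} ->
  {in s &, forall x x', (p %| x - x')%Z -> x = x'} ->
  (size s <= k)%N.
Proof.
move=> k_gt0 p_pr us sk sinj.
have chp := pchar_Fp p_pr.
pose h (x : int) : 'F_p := x%:~R.
pose P : {poly 'F_p} := 'X^k - ((h y) ^+ k)%:P.
have szP : size P = k.+1 by rewrite size_XnsubC.
rewrite -ltnS -szP -(size_map h); apply: max_poly_roots.
- by rewrite -size_poly_gt0 szP.
- apply/allP => _ /mapP[x xs ->]; rewrite rootE /P !hornerE.
  by rewrite /h -!rmorphXn -rmorphB /= -(dvdz_pcharf chp) sk.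
- rewrite map_inj_in_uniq // => x x' xs x's /eqP.
  by rewrite -subr_eq0 -rmorphB /= -(dvdz_pcharf chp) => /(sinj _ _ xs x's).
Qed.

(** Coprimality to [y] keeps [p] from dividing any [x]. Let [v] be the valuation of [k]. If [v = 0],
    the elements are determined modulo [p] and give roots of a polynomial over [F_p]. If [v > 0],
    elements that agree modulo [p ^ (v + 1)] agree modulo [p ^ (a - v)], so [v] further digits in
    base [p] determine them; this leaves [p ^ (2 v + 1) <= k ^ 3] cases, as [p <= p ^ v <= k]. *)
Lemma size_roots_prime_power (k p a : nat) (y : int) (s : seq int) :
  (0 < k)%N -> prime p -> (0 < a)%N -> uniq s ->
  {in s, forall x, coprimez x y} ->
  {in s, forall x, ((p ^ a)%N %| x ^+ k - y ^+ k)%Z} ->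
  {in s &, forall x x', ((p ^ a)%N %| x - x')%Z -> x = x'} ->
  (size s <= k ^ 3)%N.
Proof.
move=> k_gt0 p_pr a_gt0 us cop sk sinj; set v := logn p k.
have p_gt0 := prime_gt0 p_pr.
have pdv x : x \in s -> ~~ (p %| x)%Z.
  move=> xs; apply/negP => px; have := cop _ xs.
  have py : (p %| y ^+ k)%Z.
    rewrite -(rpredBl _ (dvdz_exp k_gt0 px)).
    by apply: dvdz_trans (sk _ xs); rewrite dvdzE /= dvdn_exp.
  move: px py; rewrite !dvdzE abszX /= Euclid_dvdX // k_gt0 andbT => px py.
  rewrite coprimezE => /(coprime_dvdl px); rewrite prime_coprime //.
  by rewrite py.
have close x x' : x \in s -> x' \in s -> ((p ^ v.+1)%N %| x - x')%Z ->
    ((p ^ a)%N %| (p ^ v)%N%:Z * (x - x'))%Z.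
  move=> xs x's h; apply: (dvdz_sub_of_subX k_gt0 p_pr (pdv _ x's) h).
  have -> : x ^+ k - x' ^+ k = (x ^+ k - y ^+ k) - (x' ^+ k - y ^+ k) by ring.
  by rewrite rpredB // sk.
have [v0|v_gt0] := posnP v.
  apply: leq_trans (_ : k <= _)%N; last by rewrite -{1}[k]expn1 leq_pexp2l.
  apply: (size_roots_Fp k_gt0 p_pr us).
    move=> x /sk; apply: dvdz_trans.
    by rewrite dvdzE /= dvdn_exp.
  move=> x x' xs x's pxx; apply: sinj => //.
  by have := close x x' xs x's; rewrite v0 expn1 expn0 mul1r; apply.
pose f (x : int) := (`|(x %% (p ^ v.+1)%N)%Z|%N,
   `|((x %/ (p ^ (a - v))%N)%Z %% (p ^ v)%N)%Z|%N).
pose r := [seq (i, j) | i <- iota 0 (p ^ v.+1), j <- iota 0 (p ^ v)].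
have le_pv : (p ^ v <= k)%N by apply: dvdn_leq => //; apply: pfactor_dvdnn.
have le_p : (p <= k)%N.
  by apply: leq_trans le_pv; rewrite -{1}[p]expn1 leq_pexp2l.
have szr : (size r <= k ^ 3)%N.
  rewrite size_allpairs !size_iota expnS !expnS expn0 muln1 -mulnA.
  by rewrite !leq_mul.
apply: leq_trans szr; apply: (@size_leq_inj _ _ f) => //; last first.
  by move=> x xs; apply: allpairs_f; rewrite mem_iota_absz_modz // expn_gt0 p_gt0.
move=> x x' xs x's [/absz_modz_inj e1 /absz_modz_inj e2].
apply: sinj => //; have {}e1 := close _ _ xs x's (e1 _).
have {}e1 := e1 ltac:(by rewrite expn_gt0 p_gt0).
have {}e2 := e2 ltac:(by rewrite expn_gt0 p_gt0).
(* For [a <= v] the truncated [a - v] is [0], so the second component of [f] is [x] modulo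
   [p ^ v]. *)
have [le_av|lt_va] := leqP a v.
  move: e2; have -> : (a - v = 0)%N by lia.
  by rewrite expn0 !divz1; apply: dvdz_trans; rewrite dvdzE /= dvdn_exp2l.
have pE : (p ^ a = p ^ v * p ^ (a - v))%N by rewrite -expnD subnKC // ltnW.
have pv0 : (p ^ v)%N%:Z != 0 by rewrite -lt0n expn_gt0 p_gt0.
move: e1; rewrite {1}pE PoszM dvdz_mul2l // => e1.
have : x - x' = ((x %/ (p ^ (a - v))%N)%Z - (x' %/ (p ^ (a - v))%N)%Z) * (p ^ (a - v))%N.
  rewrite {1}(divz_eq x (p ^ (a - v))%N) {1}(divz_eq x' (p ^ (a - v))%N).
  have -> : (x %% (p ^ (a - v))%N)%Z = (x' %% (p ^ (a - v))%N)%Z.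
    by apply/eqP; rewrite eqz_mod_dvd.
  by ring.
by move=> ->; rewrite pE PoszM dvdz_mul.
Qed.

(* The residues modulo the prime powers are treated one prime at a time, so
   that the Chinese remainder theorem is not needed. *)
Lemma size_roots (k g : nat) (y : int) (s : seq int) :
  (0 < k)%N -> (0 < g)%N -> uniq s ->
  {in s, forall x, coprimez x y} ->
  {in s, forall x, (g %| x ^+ k - y ^+ k)%Z} ->
  {in s &, forall x x', (g %| x - x')%Z -> x = x'} ->
  (size s <= size (divisors g) ^ (3 * k))%N.
Proof.
move=> k_gt0 g_gt0 us cop sk sinj.
have pr p : p \in primes g -> prime p by rewrite mem_primes => /and3P[].
have lg p : p \in primes g -> (0 < logn p g)%N by rewrite logn_gt0.
have pg p : ((p ^ logn p g)%N %| g%:Z)%Z by rewrite dvdzE /= pfactor_dvdnn.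
have {}sinj : {in s &, forall x x',
    (forall p, p \in primes g -> ((p ^ logn p g)%N %| x - x')%Z) -> x = x'}.
  move=> x x' xs x's H; apply: sinj => //; rewrite dvdzE /=.
  apply/dvdn_partP => // p pgg; rewrite p_part.
  by have := H p pgg; rewrite dvdzE.
have : (size s <= (k ^ 3) ^ size (primes g))%N.
  (* Induction on the list of primes that still have to separate the elements of [s]; each prime
     splits [s] into residue classes. *)
  suff key ps : {subset ps <= primes g} -> {in s &, forall x x',
      (forall p, p \in ps -> ((p ^ logn p g)%N %| x - x')%Z) -> x = x'} ->
      (size s <= (k ^ 3) ^ size ps)%N by exact: key.
  move=> sub {sinj}; elim: ps s us cop sk sub => [|p ps IHp] s us cop sk sub sinj.
    rewrite expn0 -[1%N]/(size [:: tt]).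
    apply: (@size_leq_inj _ _ (fun=> tt)) => // x x' xs x's _.
    exact: sinj.
  have pin : p \in primes g by apply/sub/mem_head.
  rewrite /= expnS.
  have p_gt0 : (0 < p ^ logn p g)%N by rewrite expn_gt0 prime_gt0 ?pr.
  pose f (x : int) := `|(x %% (p ^ logn p g)%N)%Z|%N.
  pose r := undup (map f s).
  apply: leq_trans (size_leq_fibres (f := f) (r := r)
      (m := (k ^ 3) ^ size ps) _ _) _.
  - by move=> x xs; rewrite mem_undup map_f.
  - move=> u ur; apply: IHp.
    + by rewrite filter_uniq.
    + by move=> x; rewrite mem_filter => /andP[_ /cop].
    + by move=> x; rewrite mem_filter => /andP[_ /sk].
    + by move=> q qps; apply: sub; rewrite inE qps orbT.
    + move=> x x'; rewrite !mem_filter => /andP[/eqP fx xs] /andP[/eqP fx' x's] H.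
      apply: sinj => // q; rewrite inE => /orP[/eqP->|]; last exact: H.
      by apply: absz_modz_inj; rewrite // -/(f x) fx -/(f x').
  rewrite leq_mul2r; apply/orP; right.
  (* One representative of each class: they are pairwise incongruent, so the prime power case bounds
     the number of classes. *)
  pose s' := [seq nth 0 s (index u (map f s)) | u <- r].
  have fs' : map f s' = r.
    rewrite -map_comp -[RHS]map_id; apply/eq_in_map => u; rewrite mem_undup => us'.
    by rewrite /= -(nth_map 0 0%N) ?nth_index // -(size_map f) index_mem.
  have s's : {subset s' <= s}.
    move=> _ /mapP[u us' ->]; apply: mem_nth; rewrite -(size_map f) index_mem.
    by rewrite mem_undup in us'.
  have us' : uniq s' by apply: (@map_uniq _ _ f); rewrite fs' undup_uniq.
  have <- : size s' = size r by rewrite size_map.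
  apply: (@size_roots_prime_power k p (logn p g) y) => //; rewrite ?pr ?lg //.
  + by move=> x /s's /cop.
  + by move=> x /s's /sk; apply: dvdz_trans.
  + have finj : {in s' &, injective f}.
      move=> x x' /(nthP 0)[i li <-] /(nthP 0)[j lj <-] /eqP.
      rewrite -!(nth_map 0 0%N f) // fs' nth_uniq ?undup_uniq //.
        by move/eqP->.
        by rewrite -fs' size_map.
      by rewrite -fs' size_map.
    move=> x x' xs x's; rewrite -eqz_mod_dvd => /eqP e.
    by apply: finj => //; rewrite /f e.
move/leq_trans; apply.
(* [k ^ 3 <= 2 ^ (3 k)], and [2] to the number of primes of [g] is at most the number of divisors of
   [g]. *)
apply: leq_trans (_ : (2 ^ (3 * k)) ^ size (primes g) <= _)%N.
  by rewrite leq_expn2r // mulnC expnM leq_expn2r // ltnW // ltn_expl.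
rewrite -expnM mulnC expnM leq_expn2r // size_divisors.
rewrite -(count_predT (primes g)) -iter_muln_1 -big_const_seq.
by rewrite big_seq [leqRHS]big_seq; apply: leq_prod => p /lg.
Qed.

(** * Power differences in a fixed residue class *)

Lemma leq_expnD (k a b : nat) : (0 < k)%N -> (a ^ k + b ^ k <= (a + b) ^ k)%N.
Proof.
case: k => // k _; elim: k => [|k IHk]; first by rewrite !expn1.
rewrite expnS [X in (_ + X)%N]expnS [leqRHS]expnS.
apply: leq_trans (leq_mul (leqnn _) IHk); nia.
Qed.

(** After the reverse triangle inequality, [leq_expnD] applies to [b = a + (b - a)]. The result
    confines [|x|] to a short interval around [|y|]. *)
Lemma leq_distX (k : nat) (x y : int) : (0 < k)%N ->
  (`| `|x|%N%:Z - `|y|%N%:Z | ^ k <= `|x ^+ k - y ^+ k|)%N.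
Proof.
move=> k_gt0.
have : (`| (`|x| ^ k)%N%:Z - (`|y| ^ k)%N%:Z | <= `|x ^+ k - y ^+ k|)%N.
  by have := ler_dist_dist (x ^+ k) (y ^+ k); rewrite !normrX !PoszX !abszE.
apply: leq_trans; move: `|x|%N `|y|%N => a b {x y}.
wlog le_ab : a b / (a <= b)%N => [H|].
  have [|lt_ba] := leqP a b; first exact: H.
  by rewrite ![ `|Posz a - _|%N]distnC [ `|Posz (a ^ k) - _|%N]distnC H // ltnW.
have := @leq_expnD k a (b - a) k_gt0; rewrite subnKC // => le.
have := leq_expn2r k le_ab; rewrite [ `|Posz a - _|%N]distnC distnEl //.
lia.
Qed.

Lemma dvdz_sub_small (m : nat) (a b : int) :
  (m %| a - b)%Z -> (`|(a - b)%R| < m)%N -> a = b.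
Proof.
rewrite dvdzE /= => dv lt; apply/eqP; rewrite -subr_eq0 -absz_eq0 -leqn0 leqNgt.
by apply: contraL lt => /dvdn_leq/(_ dv); rewrite -leqNgt.
Qed.

Lemma distn_divn_lt (m a b : nat) : (0 < m)%N -> (a %/ m = b %/ m)%N ->
  (`|a%:Z - b%:Z| < m)%N.
Proof.
move=> m_gt0 e; have := divn_eq a m; have := divn_eq b m; rewrite -e.
have := ltn_pmod a m_gt0; have := ltn_pmod b m_gt0.
move: (_ * m)%N (_ %% _)%N (_ %% _)%N => q r s; clear; lia.
Qed.

(* The sign of [a], its position relative to [c] and the quotient of the distance
   from [|a|] to [c] by [m] locate [a] in an interval of length [m]. *)
Lemma eq_of_dist_quotient (m c : nat) (a b : int) : (0 < m)%N ->
  (0 <= a) = (0 <= b) -> (c <= `|a|)%N = (c <= `|b|)%N ->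
  (`| `|a|%N%:Z - c%:Z| %/ m = `| `|b|%N%:Z - c%:Z| %/ m)%N ->
  (m %| a - b)%Z -> a = b.
Proof.
move=> m_gt0 sgn side /(distn_divn_lt m_gt0) lt /dvdz_sub_small; apply.
apply: leq_ltn_trans lt => {m m_gt0}.
have -> : `|(a - b)%R|%N = `| `|a|%N%:Z - `|b|%N%:Z|%N by move: sgn; clear; lia.
move: `|a|%N `|b|%N side => {a b sgn} a b; case: leqP => ca /esym cb.
  by rewrite (distnEl ca) (distnEl cb); clear -ca cb; lia.
move/negbT: cb; rewrite -ltnNge => cb.
by rewrite (distnEr (ltnW ca)) (distnEr (ltnW cb)); clear -ca cb; lia.
Qed.

(** Sort [s] by the label [f]: [e = gcd(x, y)], the sign of [x], the side of [|x|] relative to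
    [|y|], and the index [w] of the block of length [G e], counted from [|y| / e], that contains
    [|x| / e]. There are at most [T * 4 * (Q + 1)] labels. Divided by [e], the elements with one
    label are coprime to [y / e], solve the congruence modulo [G e] and are pairwise incongruent, so
    [size_roots] applies. *)
Lemma size_power_congruence (k g D Q T : nat) (y : int) (s : seq int) :
  (0 < k)%N -> (0 < g)%N -> y != 0 -> uniq s ->
  {in s, forall x, (g %| x ^+ k - y ^+ k)%Z} ->
  {in s, forall x, (`|x ^+ k - y ^+ k| <= D)%N} ->
  (forall w, (w ^ k * g <= D)%N -> (w <= Q)%N) ->
  (size (divisors `|y|) <= T)%N ->
  (forall g', (g' %| g)%N -> (size (divisors g') <= T)%N) ->
  (size s <= T * 4 * Q.+1 * T ^ (3 * k))%N.
Proof.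
move=> k_gt0 g_gt0 y0 us sg sD maxQ Ty Tg.
have y_gt0 : (0 < `|y|)%N by lia.
pose G e := (g %/ gcdn g (e ^ k))%N.
have G_gt0 e : (0 < G e)%N by rewrite divn_gt0 ?gcdn_gt0 ?g_gt0 // dvdn_leq ?dvdn_gcdl.
pose ex (x : int) := gcdn `|x| `|y|.
have ex_gt0 x : (0 < ex x)%N by rewrite gcdn_gt0 y_gt0 orbT.
pose w x := (`| (`|x| %/ ex x)%N%:Z - (`|y| %/ ex x)%N%:Z | %/ G (ex x))%N.
pose f x := (ex x, (0 <= x, (`|y| <= `|x|)%N), w x).
pose r := [seq (u, v) | u <- [seq (e, b) | e <- divisors `|y|, b <- enum {: bool * bool}],
   v <- iota 0 Q.+1].
have szr : (size r <= T * 4 * Q.+1)%N.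
  rewrite !size_allpairs size_iota -cardE card_prod card_bool.
  by rewrite !leq_mul2r Ty !orbT.
apply: leq_trans (leq_mul szr (leqnn _)).
apply: (size_leq_fibres (f := f)) => [x xs|[[e b] v] _].
  apply: allpairs_f.
    by apply: allpairs_f; rewrite ?mem_enum // -dvdn_divisors // dvdn_gcdr.
  rewrite mem_iota /= add0n ltnS; apply: maxQ.
  apply: leq_trans (sD _ xs); apply: leq_trans (leq_distX _ _ k_gt0).
  set e := ex x; have e_gt0 : (0 < e)%N := ex_gt0 x.
  have -> : `| `|x|%N%:Z - `|y|%N%:Z |%N
      = (`| (`|x| %/ e)%N%:Z - (`|y| %/ e)%N%:Z | * e)%N.
    rewrite -[in RHS](absz_nat e) -abszM mulrBl -!PoszM !divnK //.
      exact: dvdn_gcdr.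
    exact: dvdn_gcdl.
  set dl := `|_ - Posz (`|y| %/ e)|%N.
  have le1 : (w x * G e <= dl)%N by rewrite /w -/e leq_divM.
  apply: leq_trans (_ : (w x * G e * e) ^ k <= _)%N; last first.
    by rewrite leq_expn2r // leq_mul2r le1 orbT.
  (* It remains to see that [g = G e * gcd(g, e ^ k) <= (G e) ^ k * e ^ k]. *)
  rewrite !expnMn -mulnA leq_mul2l; apply/orP; right.
  have gE : (G e * gcdn g (e ^ k) = g)%N by rewrite divnK ?dvdn_gcdl.
  rewrite -{1}gE; apply: leq_mul.
    by rewrite -{1}[G e]expn1 leq_pexp2l.
  by rewrite dvdn_leq ?dvdn_gcdr // expn_gt0 e_gt0.
set se := [seq x <- s | f x == (e, b, v)].
have [->//|nz] := eqVneq se [::].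
have seP x : x \in se -> [/\ x \in s, ex x = e, (0 <= x, (`|y| <= `|x|)%N) = b & w x = v].
  by rewrite mem_filter => /andP[/eqP[<- <- <-] ->].
have e_gt0 : (0 < e)%N.
  case: se nz seP => // x l _ /(_ x (mem_head _ _))[_ <- _ _]; exact: ex_gt0.
have ye : (e %| y)%Z.
  case: se nz seP => // x l _ /(_ x (mem_head _ _))[_ <- _ _].
  by rewrite dvdzE /= dvdn_gcdr.
have xe x : x \in se -> (e %| x)%Z.
  by case/seP => _ <- _ _; rewrite dvdzE /= dvdn_gcdl.
have e0 : e%:Z != 0 by lia.
pose h (x : int) := (x %/ e)%Z.
have hK : {in se, forall x, h x * e%:Z = x} by move=> x /xe /divzK.
have yK : h y * e%:Z = y by apply: divzK.
have hinj : {in se &, injective h} 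
  by move=> x x' xs x's hE; rewrite -(hK _ xs) hE hK.
rewrite -(size_map h).
apply: leq_trans (_ : size (divisors (G e)) ^ (3 * k) <= _)%N; last first.
  by rewrite leq_expn2r // Tg // dvdn_div // dvdn_gcdl.
apply: (@size_roots k (G e) (h y)) => //.
- by rewrite map_inj_in_uniq // filter_uniq.
- move=> _ /mapP[x xse ->]; have [_ exE _ _] := seP _ xse.
  rewrite coprimezE /coprime -(eqn_pmul2r e_gt0) mul1n muln_gcdl.
  by rewrite -[X in gcdn (_ * X) (_ * X)](absz_nat e) -!abszM hK // yK -/(ex x) exE.
- move=> _ /mapP[x xse ->]; have [xs _ _ _] := seP _ xse.
  have := sg _ xs; rewrite -{1}(hK _ xse) -{1}yK !exprMn -mulrBl -PoszX.
  rewrite !dvdzE abszM /= => gd.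
  have gE : (G e * gcdn g (e ^ k) = g)%N by rewrite divnK ?dvdn_gcdl.
  have gc_gt0 : (0 < gcdn g (e ^ k))%N by rewrite gcdn_gt0 g_gt0.
  have eE : (e ^ k %/ gcdn g (e ^ k) * gcdn g (e ^ k) = e ^ k)%N.
    by rewrite divnK ?dvdn_gcdr.
  (* Cancelling [gcd(g, e ^ k)] leaves the modulus [G e], which is coprime to what remains of
     [e ^ k]. *)
  have cop : coprime (G e) (e ^ k %/ gcdn g (e ^ k)).
    by rewrite /coprime -(eqn_pmul2r gc_gt0) muln_gcdl gE eE mul1n.
  rewrite -(Gauss_dvdl _ cop) -(dvdn_pmul2r gc_gt0) gE -mulnA eE //.
move=> _ _ /mapP[x xse ->] /mapP[x' x'se ->].
have [_ ex1 b1 w1] := seP _ xse; have [_ ex2 b2 w2] := seP _ x'se.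
move: b2; rewrite -b1 => -[sgn side].
have absK (z : int) : `|(z * e%:Z)%R|%N = (`|z| * e)%N by rewrite abszM absz_nat.
move: w1 w2; rewrite /w ex1 ex2.
have aK (z : int) : (e %| z)%Z -> (`|z| %/ e)%N = `|h z|%N.
  by move=> /divzK ez; rewrite -{1}ez absK mulnK.
rewrite !(aK _ ye) (aK _ (xe _ xse)) (aK _ (xe _ x'se)) => w1 w2.
have side' : (`|h y| <= `|h x'|)%N = (`|h y| <= `|h x|)%N.
  rewrite -[LHS](leq_pmul2r e_gt0) -[RHS](leq_pmul2r e_gt0) -!absK yK.
  by rewrite !hK.
have sgn' : (0 <= h x') = (0 <= h x).
  have ep : 0 < e%:Z by lia.
  by rewrite -[LHS](pmulr_lge0 _ ep) -[RHS](pmulr_lge0 _ ep) !hK.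
exact: eq_of_dist_quotient (G_gt0 e) (esym sgn') (esym side') (etrans w1 (esym w2)).
Qed.

(** * Counting in boxes *)

(** Encodes the integers of absolute value at most [n], read off by [box_int], as a finite type, so
    that cardinals and finite sums are available. *)
Definition box (n : nat) : finType := 'I_(n + n).+1.

Definition box_int (n : nat) (i : box n) : int := (i : nat)%:Z - n%:Z.

Lemma box_int_inj (n : nat) : injective (@box_int n).
Proof. by move=> i j e; apply: ord_inj; rewrite /box_int in e; lia. Qed.

Lemma box_int_le (n : nat) (i : box n) : (`|box_int i| <= n)%N.
Proof. by rewrite /box_int; case: i => i /= ?; lia. Qed.

Lemma card_leq_size (S : finType) (U : eqType) (f : S -> U) (A : {set S}) (m : nat) :
  injective f ->
  (forall s : seq U, uniq s -> (forall x, x \in s -> exists2 i, i \in A & x = f i) ->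
     (size s <= m)%N) ->
  (#|A| <= m)%N.
Proof.
move=> injf H; rewrite cardE -(size_map f); apply: H.
  by rewrite map_inj_uniq ?enum_uniq.
by move=> _ /mapP[i iA ->]; exists i; rewrite // -mem_enum.
Qed.

Lemma card_prod_sum (S U : finType) (A : {set S * U}) :
  #|A| = (\sum_y #|[set x | (x, y) \in A]|)%N.
Proof.
rewrite -sum1_card big_mkcond /=.
rewrite (eq_bigr (fun p => if (p.1, p.2) \in A then 1%N else 0%N)); last by case.
rewrite -(pair_bigA _ (fun x y => if (x, y) \in A then 1%N else 0%N)) /=.
rewrite exchange_big /=; apply: eq_bigr => y _.
by rewrite -big_mkcond sum1dep_card.
Qed.

Definition pow_diff (k N : nat) (p : box N * box N) : int :=
  box_int p.1 ^+ k - box_int p.2 ^+ k.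

(** [x ^ k = y ^ k] forces [|x| = |y|], so once [y] is given only the sign of [x] is free. *)
Lemma card_pow_diff_eq0 (k N : nat) : (0 < k)%N ->
  (#|[set p : box N * box N | pow_diff k p == 0]| <= (N + N).+1 * 2)%N.
Proof.
move=> k_gt0; rewrite card_prod_sum.
apply: leq_trans (_ : \sum_(y : box N) 2 <= _)%N; last by rewrite sum_nat_const card_ord.
apply: leq_sum => y _; apply: (card_leq_size (@box_int_inj N)) => s us sP.
apply: (@size_leq_inj _ _ (fun x => 0 <= x) [:: true; false]) => //; last first.
  by move=> x _; case: (0 <= x).
have absE x : x \in s -> `|x|%N = `|box_int y|%N.
  case/sP => i; rewrite !inE /pow_diff /= subr_eq0 => /eqP e ->.
  by apply: (expIn k_gt0); rewrite -!abszX e.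
by move=> x x' /absE + /absE; lia.
Qed.

Lemma absz_pow_diff_le (k N : nat) (p : box N * box N) :
  (`|pow_diff k p| <= 2 * N ^ k)%N.
Proof.
have le i : (`|@box_int N i ^+ k| <= N ^ k)%N by rewrite abszX leq_expn2r // box_int_le.
have := le p.1; have := le p.2; rewrite /pow_diff; lia.
Qed.

(** Fix [y]. For [y <> 0] there are at most [X] values of [x] by [size_power_congruence]; for
    [y = 0] all [2 N + 1] values are counted. *)
Lemma card_pow_diff_dvd (k N g D Q T : nat) :
  (0 < k)%N -> (0 < N)%N -> (0 < g)%N -> (g <= 2 * N ^ k)%N -> (0 < Q)%N ->
  (forall w, (w ^ k * g <= D)%N -> (w <= Q)%N) ->
  (forall n, (0 < n)%N -> (n <= 2 * N ^ k)%N -> (size (divisors n) <= T)%N) ->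
  (#|[set p : box N * box N | (g %| pow_diff k p)%Z && (`|pow_diff k p| <= D)%N]|
     <= 27 * N * Q * T ^ (3 * k).+1)%N.
Proof.
move=> k_gt0 N_gt0 g_gt0 g_le Q_gt0 maxQ HT.
pose X := (T * 4 * Q.+1 * T ^ (3 * k))%N.
have T_gt0 : (0 < T)%N.
  by apply: leq_trans (HT 1%N _ _); rewrite ?muln_gt0 ?expn_gt0 ?N_gt0.
rewrite card_prod_sum.
apply: leq_trans (_ : \sum_(y : box N) ((y == inord N) * (N + N).+1 + X) <= _)%N.
  apply: leq_sum => y _; have [y0|y0] := eqVneq (box_int y) 0.
    (* [inord N] encodes the integer [0]. *)
    have -> : y == inord N.
      apply/eqP/val_inj; rewrite /= inordK; move: y0; rewrite /box_int; lia.
    rewrite mul1n; apply: leq_trans (leq_addr _ _).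
    by rewrite -[leqRHS]card_ord max_card.
  apply: leq_trans (leq_addl _ _).
  apply: (card_leq_size (@box_int_inj N)) => s us sP.
  apply: (@size_power_congruence k g D Q T (box_int y)) => //.
  - by move=> _ /sP[i + ->]; rewrite !inE => /andP[].
  - by move=> _ /sP[i + ->]; rewrite !inE => /andP[].
  - apply: HT; first by lia.
    apply: leq_trans (box_int_le _) _.
    by apply: leq_trans (leq_pmull _ _) => //; rewrite -{1}[N]expn1 leq_pexp2l.
  - move=> g' g'g; apply: HT; first by case: g' g'g => //; rewrite dvd0n; lia.
    by apply: leq_trans g_le; apply: dvdn_leq.
rewrite big_split /= sum_nat_const card_ord -big_distrl /=.
have -> : (\sum_(y : box N) (y == inord N :> box N) = 1)%N.
  by rewrite (bigD1 (inord N)) //= eqxx big1 // => i /negbTE->.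
(* Here [Q + 1 <= 2 Q] gives the constant [8]; the row [y = 0] raises it to [9], and
   [2 N + 1 <= 3 N] to [27]. *)
have Xle : (X <= 8 * Q * T ^ (3 * k).+1)%N.
  rewrite /X expnS; apply: leq_trans (_ : T * 4 * (2 * Q) * T ^ (3 * k) <= _)%N; last by lia.
  by rewrite leq_mul2r leq_mul2l; apply/orP; right; apply/orP; right; lia.
have P_gt0 : (0 < T ^ (3 * k).+1)%N by rewrite expn_gt0 T_gt0.
move: Xle P_gt0; move: X (T ^ _)%N => X P Xle P_gt0.
have le1 : (1 + X <= 9 * (Q * P))%N by nia.
apply: leq_trans (_ : (N + N).+1 * (9 * (Q * P)) <= _)%N; last by nia.
by rewrite mul1n -{1}[(N + N).+1]muln1 -mulnDr leq_mul2l le1 orbT.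
Qed.

(** Solutions differ by multiples of [m = g / h], so the box holds at most [2 M / m + 1] of them;
    multiply by [g = m h] and use [m <= g <= M]. *)
Lemma card_linear_congruence (M g : nat) (c d : int) :
  (0 < g)%N -> (g <= M)%N ->
  (#|[set i : box M | (g %| (c + box_int i * d)%R)%Z]| * g <= 3 * M * gcdn `|d| g)%N.
Proof.
move=> g_gt0 gM; set h := gcdn _ _.
have h_gt0 : (0 < h)%N by rewrite gcdn_gt0 g_gt0 orbT.
pose m := (g %/ h)%N.
have gE : (m * h = g)%N by rewrite divnK ?dvdn_gcdr.
have m_gt0 : (0 < m)%N by rewrite divn_gt0 // dvdn_leq ?dvdn_gcdr.
have dE : (`|d| %/ h * h = `|d|)%N by rewrite divnK ?dvdn_gcdl.
have cop : coprime m (`|d| %/ h).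
  by rewrite /coprime gcdnC -(eqn_pmul2r h_gt0) muln_gcdl gE dE mul1n.
have le : (#|[set i : box M | (g %| (c + box_int i * d)%R)%Z]| <= ((M + M) %/ m).+1)%N.
  apply: (card_leq_size (@ord_inj _)) => s us sP.
  rewrite -[leqRHS](size_iota 0).
  apply: (@size_leq_inj _ _ (fun i => i %/ m)%N) => // [i j|i].
    case/sP => i' + ->; rewrite inE => gi /sP[j' + ->]; rewrite inE => gj.
    have : (g %| (box_int i' - box_int j') * d)%Z.
      have -> : (box_int i' - box_int j') * d
        = (c + box_int i' * d) - (c + box_int j' * d) by ring.
      exact: rpredB.
    rewrite dvdzE abszM /= -gE -{1}dE mulnA dvdn_pmul2r // (Gauss_dvdl _ cop).
    have -> : box_int i' - box_int j' = i'%:Z - j'%:Z by rewrite /box_int; ring.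
    move=> dv /(distn_divn_lt m_gt0) lt.
    have ij : i'%:Z = j'%:Z by apply: dvdz_sub_small lt; rewrite dvdzE.
    by case: ij.
  case/sP => i' _ ->; rewrite mem_iota /= add0n ltnS leq_div2r //.
  by case: i' => i' /=; rewrite ltnS.
apply: leq_trans (leq_mul le (leqnn g)) _.
rewrite -{1}gE mulnA leq_mul2r; apply/orP; right.
rewrite mulSn; have := leq_divM (M + M) m.
have : (m <= g)%N by rewrite leq_divLR ?leq_pmulr ?dvdn_gcdr.
lia.
Qed.

Definition ffun_insert (I : finType) (n : nat) (j0 : 'I_n.+1)
    (u : I * {ffun 'I_n -> I}) : {ffun 'I_n.+1 -> I} :=
  [ffun j => if unlift j0 j is Some j' then u.2 j' else u.1].

Lemma ffun_insert_at (I : finType) n (j0 : 'I_n.+1) (u : I * {ffun 'I_n -> I}) :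
  ffun_insert j0 u j0 = u.1.
Proof. by rewrite ffunE unlift_none. Qed.

Lemma ffun_insert_lift (I : finType) n (j0 : 'I_n.+1) (u : I * {ffun 'I_n -> I}) j :
  ffun_insert j0 u (lift j0 j) = u.2 j.
Proof. by rewrite ffunE liftK. Qed.

Lemma ffun_insertK (I : finType) n (j0 : 'I_n.+1) (a : {ffun 'I_n.+1 -> I}) :
  ffun_insert j0 (a j0, [ffun j => a (lift j0 j)]) = a.
Proof.
by apply/ffunP => j; rewrite ffunE; case: unliftP => [j'|] -> //=; rewrite ffunE.
Qed.

Lemma ffun_insert_bij (I : finType) n (j0 : 'I_n.+1) : bijective (@ffun_insert I n j0).
Proof.
exists (fun a : {ffun 'I_n.+1 -> I} => (a j0, [ffun j : 'I_n => a (lift j0 j)])); last first.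
  exact: ffun_insertK.
case=> i b; rewrite ffun_insert_at; congr (_, _).
by apply/ffunP => j; rewrite ffunE ffun_insert_lift.
Qed.

Lemma sum_ffun_insert (I : finType) n (j0 : 'I_n.+1) (F : {ffun 'I_n.+1 -> I} -> nat) :
  (\sum_a F a = \sum_i \sum_b F (ffun_insert j0 (i, b)))%N.
Proof.
rewrite (reindex (@ffun_insert I n j0)); last exact/onW_bij/ffun_insert_bij.
by rewrite pair_bigA /=; apply: eq_bigr => -[i b].
Qed.

Lemma dvdn_big_gcdn (I : finType) (F : I -> nat) (D : nat) :
  (\big[gcdn/D]_i F i %| D)%N /\ forall i, (\big[gcdn/D]_j F j %| F i)%N.
Proof.
split=> [|i].
  by elim/big_rec: _ => // j x _; apply: dvdn_trans; rewrite dvdn_gcdr.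
elim: (index_enum _) (mem_index_enum i) => // j s IHs.
rewrite inE big_cons => /orP[/eqP->|/IHs]; first exact: dvdn_gcdl.
by apply: dvdn_trans; rewrite dvdn_gcdr.
Qed.

(** Induction on [n]. Let [g] be the gcd of [D] and all coefficients but the first. A first
    coordinate extends to a solution only if it solves a linear congruence modulo [g]. By induction
    it then has at most [(3 M) ^ n g / D] extensions, and this [g] cancels against the one in
    [card_linear_congruence]. *)
Lemma card_multilinear_congruence (n M D : nat) (d : 'I_n -> int) (c : int) :
  (0 < D)%N -> (D <= M)%N ->
  (#|[set a : {ffun 'I_n -> box M} | (D %| (c + \sum_j box_int (a j) * d j)%R)%Z]| * D
     <= (3 * M) ^ n * \big[gcdn/D]_(j < n) `|d j|)%N.
Proof.
move=> D_gt0 DM; elim: n d c => [|n IHn] d c.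
  rewrite big_ord0 leq_mul2r; apply/orP; right.
  by apply: leq_trans (max_card _) _; rewrite card_ffun [X in (_ ^ X)%N]card_ord !expn0.
rewrite big_ord_recl; set g := \big[gcdn/D]_(i < n) _.
have [gD gd] := dvdn_big_gcdn (fun j => `|d (lift ord0 j)|%N) D.
have g_gt0 : (0 < g)%N by rewrite (dvdn_gt0 D_gt0).
pose cnt (i : box M) := #|[set b : {ffun 'I_n -> box M} |
   (D %| (c + box_int i * d ord0) + \sum_j box_int (b j) * d (lift ord0 j))%Z]|.
have -> : #|[set a : {ffun 'I_n.+1 -> box M} |
    (D %| (c + \sum_j box_int (a j) * d j)%R)%Z]| = (\sum_i cnt i)%N.
  rewrite -sum1dep_card big_mkcond /= (sum_ffun_insert ord0).
  apply: eq_bigr => i _; rewrite /cnt -sum1dep_card [RHS]big_mkcond /=.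
  apply: eq_bigr => b _; rewrite big_ord_recl ffun_insert_at addrA /=.
  by under eq_bigr do rewrite ffun_insert_lift.
rewrite big_distrl /=.
apply: leq_trans (_ : \sum_(i in [set i : box M | (g %| (c + box_int i * d ord0)%R)%Z])
    ((3 * M) ^ n * g) <= _)%N.
  rewrite [leqRHS]big_mkcond /=; apply: leq_sum => i _; rewrite inE.
  case: ifPn => [_|gi]; first exact: IHn.
  rewrite leqn0 muln_eq0 cards_eq0; apply/orP; left; apply/eqP/setP => b.
  rewrite !inE; apply/negbTE; apply: contra gi => Db.
  have gs : (g %| \sum_j box_int (b j) * d (lift ord0 j))%Z.
    by apply: rpred_sum => j _; rewrite dvdz_mull // dvdzE; apply: gd.
  rewrite -(rpredDr _ gs); apply: dvdz_trans Db; exact: gD.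
rewrite sum_nat_const mulnCA expnSr -!mulnA leq_mul2l; apply/orP; right.
by rewrite mulnA card_linear_congruence // (leq_trans _ DM) // dvdn_leq.
Qed.

(** The equation yields a congruence modulo [d j0] for the other coordinates, and these determine
    [a j0] because [d j0 <> 0]. *)
Lemma card_hyperplane (n M : nat) (d : 'I_n.+1 -> int) (j0 : 'I_n.+1) :
  (0 < `|d j0|)%N -> (`|d j0| <= M)%N ->
  (#|[set a : {ffun 'I_n.+1 -> box M} | (\sum_j box_int (a j) * d j)%R == 0]| * `|d j0|
     <= (3 * M) ^ n * \big[gcdn/`|d j0|]_(j < n) `|d (lift j0 j)|)%N.
Proof.
move=> D_gt0 DM; apply: leq_trans (card_multilinear_congruence (fun j => d (lift j0 j)) 0 D_gt0 DM).
rewrite leq_mul2r; apply/orP; right.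
pose f (a : {ffun 'I_n.+1 -> box M}) := [ffun j => a (lift j0 j)].
have sumE (a : {ffun 'I_n.+1 -> box M}) : \sum_j box_int (a j) * d j
    = box_int (a j0) * d j0 + \sum_j box_int (f a j) * d (lift j0 j).
  by rewrite (bigD1_ord j0) //=; congr (_ + _); apply: eq_bigr => j _; rewrite ffunE.
set A := [set a | _]; have finj : {in A &, injective f}.
  move=> a a'; rewrite !inE !sumE => /eqP ea /eqP ea' ff.
  have dj0 : d j0 != 0 by lia.
  have e0 : a j0 = a' j0.
    apply: box_int_inj; apply: (mulIf dj0).
    by apply: (addIr (\sum_j box_int (f a' j) * d (lift j0 j))); rewrite ea' -ff ea.
  by rewrite -(ffun_insertK j0 a) -(ffun_insertK j0 a') -/(f a) -/(f a') ff e0.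
rewrite -(card_in_imset finj); apply/subset_leq_card/fintype.subsetP => _ /imsetP[a + ->].
rewrite !inE sumE addr_eq0 add0r => /eqP ea.
by rewrite -rpredN -ea dvdz_mull // dvdzE.
Qed.

(** * The count in natural numbers *)

(** Let [Q] be the integer part of the [k]-th root of [D / g]. Each of the [n] pairs contributes a
    factor [Q]; [k] of these are absorbed by the weight, since [Q ^ k <= D / g], and the other
    [n - k] are at most [2 N]. *)
Lemma pow_diff_dvd_weight (k n N D g T X : nat) :
  (0 < k)%N -> (k <= n)%N -> (0 < N)%N -> (0 < D)%N -> (D <= 2 * N ^ k)%N ->
  (g %| D)%N ->
  (forall m, (0 < m)%N -> (m <= 2 * N ^ k)%N -> (size (divisors m) <= T)%N) ->
  (#|[set p : box N * box N | (g %| pow_diff k p)%Z && (`|pow_diff k p| <= D)%N]| ^ n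
       * (X %/ (D %/ g))
     <= (27 * N * T ^ (3 * k).+1) ^ n * (2 * N) ^ (n - k) * X)%N.
Proof.
move=> k_gt0 kn N_gt0 D_gt0 DN gD HT.
have g_gt0 : (0 < g)%N by rewrite (dvdn_gt0 D_gt0).
have gleD : (g <= D)%N by rewrite dvdn_leq.
have ex : exists w, (w ^ k * g <= D)%N by exists 1%N; rewrite exp1n mul1n.
have ub w : (w ^ k * g <= D)%N -> (w <= D)%N.
  move=> le; apply: leq_trans le; apply: leq_trans (leq_pmulr _ g_gt0).
  by case: w => // w; rewrite -{1}[w.+1]expn1 leq_pexp2l.
case: (ex_maxnP ex ub) => Q Qle maxQ.
have Q_gt0 : (0 < Q)%N by apply: maxQ; rewrite exp1n mul1n.
have Q2N : (Q <= 2 * N)%N.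
  rewrite -(leq_exp2r _ _ k_gt0); apply: leq_trans (_ : D <= _)%N.
    by apply: leq_trans Qle; rewrite leq_pmulr.
  by apply: leq_trans DN _; rewrite expnMn leq_mul2r -{1}[2%N]expn1 leq_pexp2l ?orbT.
have := @card_pow_diff_dvd k N g D Q T k_gt0 N_gt0 g_gt0 (leq_trans gleD DN) Q_gt0 maxQ HT.
set S := #|_|; set P := (T ^ _)%N => leS.
apply: leq_trans (leq_mul (leq_expn2r n leS) (leqnn _)) _.
have -> : (27 * N * Q * P = 27 * N * P * Q)%N by lia.
move: (27 * N * P)%N => C; rewrite expnMn -!mulnA leq_mul2l; apply/orP; right.
rewrite -{1}(subnK kn) expnD -mulnA; apply: leq_mul; first exact: leq_expn2r.
apply: leq_trans (leq_divM X (D %/ g)); rewrite mulnC leq_mul2l.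
by rewrite leq_divRL // Qle orbT.
Qed.

(** Coefficients may vanish here, so with the integer parts of [A] and [B] the cardinal is an upper
    bound for [U]. *)
Definition box_solutions (k t M N : nat) :=
  [set u : {ffun 'I_t -> box M} * {ffun 'I_t -> box N * box N} |
     \sum_j box_int (u.1 j) * pow_diff k (u.2 j) == 0].

Definition coef_count (k t M N : nat) (p : {ffun 'I_t -> box N * box N}) : nat :=
  #|[set a : {ffun 'I_t -> box M} | \sum_j box_int (a j) * pow_diff k (p j) == 0]|.

(** Ties are allowed: several [j] may be peaks, and summing over all of them only overcounts. *)
Definition peak (k t N : nat) (p : {ffun 'I_t -> box N * box N}) (j : 'I_t) : bool :=
  (0 < `|pow_diff k (p j)|)%N
  && [forall i, (`|pow_diff k (p i)| <= `|pow_diff k (p j)|)%N].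

(** If all differences vanish, each coefficient has [2 M + 1 <= 3 M] values and each pair at most
    [2 (2 N + 1) <= 6 N]. Otherwise an index of maximal difference is a peak. *)
Lemma card_box_solutions (k t M N : nat) :
  (0 < k)%N -> (0 < N)%N -> (2 * N ^ k <= M)%N ->
  (#|box_solutions k t M N| <= (3 * M) ^ t * (6 * N) ^ t
     + \sum_(j < t) \sum_(p : {ffun 'I_t -> box N * box N} | peak k p j)
         coef_count k M p)%N.
Proof.
move=> k_gt0 N_gt0 NM.
have M_gt0 : (0 < M)%N by apply: leq_trans NM; rewrite muln_gt0 expn_gt0 N_gt0.
have -> : #|box_solutions k t M N| = (\sum_(p : {ffun 'I_t -> box N * box N}) coef_count k M p)%N.
  rewrite card_prod_sum; apply: eq_bigr => p _; congr #|pred_of_set _|.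
  by apply/setP => a; rewrite !inE.
rewrite (bigID (fun p : {ffun 'I_t -> box N * box N} =>
  [forall j, pow_diff k (p j) == 0])) /=; apply: leq_add.
  apply: leq_trans (_ : \sum_(p : {ffun 'I_t -> box N * box N}
      | [forall j, pow_diff k (p j) == 0]) (3 * M) ^ t <= _)%N.
    apply: leq_sum => p _; apply: leq_trans (max_card _) _.
    rewrite card_ffun [X in (_ ^ X)%N]card_ord card_ord leq_expn2r //; lia.
  rewrite sum_nat_cond_const mulnC leq_mul2l; apply/orP; right.
  pose Z := [set p : box N * box N | pow_diff k p == 0].
  apply: leq_trans (_ : #|@ffun_on 'I_t Z| <= _)%N.
    apply/subset_leq_card/fintype.subsetP => p; rewrite !inE => /forallP H.
    by apply/ffun_onP => j; rewrite inE.
  rewrite card_ffun_on card_ord leq_expn2r //.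
  by apply: leq_trans (card_pow_diff_eq0 _ k_gt0) _; lia.
rewrite (exchange_big_dep xpredT) //= big_mkcond /=; apply: leq_sum => p _.
case: ifPn => // /forallPn[i i0]; set J := (\sum_(j | _) _)%N.
have [j _ maxj] := @arg_maxnP _ i xpredT (fun j => `|pow_diff k (p j)|%N) isT.
have pj : peak k p j.
  apply/andP; split; first by apply: leq_trans (maxj i isT); lia.
  by apply/forallP => i'; apply: maxj.
by rewrite /J (bigD1 j) //= leq_addr.
Qed.

Lemma coef_count_peak (k n M N : nat) (p : {ffun 'I_n.+1 -> box N * box N}) (j0 : 'I_n.+1) :
  (2 * N ^ k <= M)%N -> peak k p j0 ->
  (coef_count k M p * `|pow_diff k (p j0)|
     <= (3 * M) ^ n * \big[gcdn/`|pow_diff k (p j0)|]_(j < n) `|pow_diff k (p (lift j0 j))|)%N.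
Proof.
move=> NM /andP[D_gt0 _].
apply: (@card_hyperplane n M (fun j => pow_diff k (p j)) j0 D_gt0).
exact: leq_trans (absz_pow_diff_le _ _) NM.
Qed.

(** The gcd is at most [D], so each of the at most [(9 N ^ 2) ^ (n + 1)] choices of pairs leaves at
    most [(3 M) ^ n] coefficient vectors. Then [N ^ (n + 1) <= N ^ k <= M] trades half of the powers
    of [N] for one [M]. *)
Lemma box_solutions_le_small (k n M N : nat) :
  (0 < k)%N -> (n < k)%N -> (0 < N)%N -> (2 * N ^ k <= M)%N ->
  (#|box_solutions k n.+1 M N|
     <= (18 ^ n.+1 + n.+1 * 27 ^ n.+1) * (M * N) ^ n.+1)%N.
Proof.
move=> k_gt0 nk N_gt0 NM; apply: leq_trans (card_box_solutions _ k_gt0 N_gt0 NM) _.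
rewrite -expnMn mulnACA expnMn mulnDl leq_add2l.
apply: leq_trans (_ : n.+1 * ((3 * M) ^ n * (9 * N ^ 2) ^ n.+1) <= _)%N; last first.
  rewrite -mulnA leq_mul2l; apply/orP; right.
  have NnM : (N ^ n.+1 <= M)%N.
    apply: leq_trans NM; apply: leq_trans (leq_pmull _ _) => //.
    by rewrite leq_pexp2l.
  have -> : ((3 * M) ^ n * (9 * N ^ 2) ^ n.+1
      = 3 ^ n * 9 ^ n.+1 * M ^ n * N ^ n.+1 * N ^ n.+1)%N.
    by rewrite -mulnn !expnMn; ring.
  have -> : (27 ^ n.+1 * (M * N) ^ n.+1
      = 3 ^ n.+1 * 9 ^ n.+1 * M ^ n * N ^ n.+1 * M)%N.
    by rewrite -[27%N]/(3 * 9)%N !expnMn (expnSr M); ring.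
  apply: leq_mul NnM; rewrite !leq_mul2r; apply/orP; right.
  by rewrite leq_pexp2l ?orbT.
apply: leq_trans (_ : \sum_(j < n.+1) (3 * M) ^ n * (9 * N ^ 2) ^ n.+1 <= _)%N; last first.
  by rewrite sum_nat_const card_ord.
apply: leq_sum => j _.
apply: leq_trans (_ : \sum_(p : {ffun 'I_n.+1 -> box N * box N}) (3 * M) ^ n <= _)%N.
  rewrite big_mkcond /=; apply: leq_sum => p _; case: ifPn => // pj.
  have /andP[D_gt0 _] := pj.
  rewrite -(leq_pmul2r D_gt0); apply: leq_trans (coef_count_peak NM pj) _.
  rewrite leq_mul2l dvdn_leq ?orbT //; exact: (dvdn_big_gcdn _ _).1.
rewrite sum_nat_const card_ffun [X in (_ ^ X * _)%N]card_ord card_prod card_ord.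
by rewrite mulnC leq_mul2l leq_expn2r ?orbT //; nia.
Qed.

(** Choose the peak index, its pair (at most [9 N ^ 2] ways) and a divisor [g] of its difference (at
    most [T] ways); [W] bounds the weighted count of the remaining [n] pairs. *)
Lemma box_solutions_le_large (k n M N T : nat) :
  (0 < k)%N -> (k <= n)%N -> (0 < N)%N -> (2 * N ^ k <= M)%N ->
  (forall m, (0 < m)%N -> (m <= 2 * N ^ k)%N -> (size (divisors m) <= T)%N) ->
  (#|box_solutions k n.+1 M N| <= 18 ^ n.+1 * (M * N) ^ n.+1
     + n.+1 * 9 * 27 ^ n * 2 ^ (n - k) * 3 ^ n
       * T ^ (n * (3 * k).+1).+1 * (M ^ n * N ^ (2 * n.+1 - k)))%N.
Proof.
move=> k_gt0 kn N_gt0 NM HT; apply: leq_trans (card_box_solutions _ k_gt0 N_gt0 NM) _.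
rewrite -expnMn mulnACA expnMn leq_add2l.
set X := ((3 * M) ^ n)%N.
pose W := ((27 * N * T ^ (3 * k).+1) ^ n * (2 * N) ^ (n - k) * X)%N.
have -> : (n.+1 * 9 * 27 ^ n * 2 ^ (n - k) * 3 ^ n
    * T ^ (n * (3 * k).+1).+1 * (M ^ n * N ^ (2 * n.+1 - k))
    = n.+1 * (9 * N ^ 2 * (T * W)))%N.
  (* The powers of [N]: [2] from the peak pair, [n] from the other pairs, [n - k] from the factors
     [Q] left over. *)
  have -> : (2 * n.+1 - k = 2 + n + (n - k))%N by lia.
  rewrite /W /X !expnMn -expnM [((3 * k).+1 * n)%N]mulnC !expnD expnS.
  move: (T ^ _)%N (27 ^ n)%N (2 ^ (n - k))%N (3 ^ n)%N => z1 z2 z3 z4.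
  move: (N ^ n)%N (N ^ (n - k))%N (M ^ n)%N (N ^ 2)%N => z5 z6 z7 z8.
  by ring.
apply: leq_trans (_ : \sum_(j < n.+1) 9 * N ^ 2 * (T * W) <= _)%N; last first.
  by rewrite sum_nat_const card_ord.
apply: leq_sum => j0 _; rewrite big_mkcond (sum_ffun_insert j0) /=.
apply: leq_trans (_ : \sum_(p : box N * box N) T * W <= _)%N; last first.
  by rewrite sum_nat_const card_prod card_ord leq_mul2r; apply/orP; right; nia.
apply: leq_sum => p1 _; set D := `|pow_diff k p1|%N.
have [D0|D_gt0] := posnP D.
  rewrite big1 // => b _.
  by rewrite /peak ffun_insert_at /= -/D D0.
have DN : (D <= 2 * N ^ k)%N := absz_pow_diff_le _ _.
pose S g := [set p : box N * box N | (g %| pow_diff k p)%Z && (`|pow_diff k p| <= D)%N].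
(* The gcd is one of the divisors of [D], and its term alone bounds the count. Summing over all
   divisors makes the conditions on the remaining pairs independent. *)
apply: leq_trans (_ : \sum_(b : {ffun 'I_n -> box N * box N})
   \sum_(g <- divisors D) (b \in ffun_on (S g)) * (X %/ (D %/ g)) <= _)%N.
  apply: leq_sum => b _; case: ifPn => // pk.
  set p := ffun_insert j0 _ in pk *.
  have := coef_count_peak NM pk.
  have /andP[_ /forallP pkm] := pk.
  have pj0 : p j0 = p1 by rewrite /p ffun_insert_at.
  rewrite pj0 -/D; set g := \big[gcdn/D]_(j < n) _ => le.
  have [gD gd] := dvdn_big_gcdn (fun j => `|pow_diff k (p (lift j0 j))|%N) D.
  rewrite -/g in gD gd.
  have g_gt0 : (0 < g)%N by rewrite (dvdn_gt0 D_gt0).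
  rewrite (bigD1_seq g) ?divisors_uniq -?dvdn_divisors //=.
  apply: leq_trans (leq_addr _ _).
  have -> : b \in ffun_on (S g).
    apply/ffun_onP => j; rewrite inE; apply/andP; split.
      by rewrite dvdzE /=; have := gd j; rewrite /p ffun_insert_lift.
    by have := pkm (lift j0 j); rewrite pj0 /p ffun_insert_lift.
  (* The rounded quotient still bounds the count, which is an integer. *)
  rewrite mul1n leq_divRL; last by rewrite divn_gt0 // dvdn_leq.
  by rewrite -(leq_pmul2r g_gt0) -mulnA divnK.
rewrite exchange_big /=.
apply: leq_trans (_ : \sum_(g <- divisors D) W <= _)%N; last first.
  rewrite big_const_seq count_predT iter_addn_0 mulnC leq_mul2r.
  by rewrite HT ?orbT.
rewrite big_seq [leqRHS]big_seq; apply: leq_sum => g; rewrite -dvdn_divisors // => gD.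
rewrite -big_distrl /=.
have -> : (\sum_(b : {ffun 'I_n -> box N * box N}) (b \in ffun_on (S g))
    = #|S g| ^ n)%N.
  rewrite -[in RHS](card_ord n) -card_ffun_on -sum1_card [RHS]big_mkcond /=.
  by apply: eq_bigr => b _; case: (_ \in _).
exact: pow_diff_dvd_weight.
Qed.

(** * The count in real numbers *)

Definition to_box (n : nat) (z : int) : box n := inord `|z + n%:Z|.

Lemma to_boxK (n : nat) (z : int) : (`|z| <= n)%N -> box_int (to_box n z) = z.
Proof. by move=> zn; rewrite /box_int /to_box inordK; lia. Qed.

(** An integer has absolute value at most [A] exactly when it is at most [Num.truncn A], so
    entrywise encoding is injective on solutions. *)
Lemma U_le_box (R : realType) (k t : nat) (A B : R) : 0 <= A -> 0 <= B ->
  (U k t A B <= #|box_solutions k t (Num.truncn A) (Num.truncn B)|)%N.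
Proof.
move=> A0 B0; set M := Num.truncn A; set N := Num.truncn B.
pose f (s : {ffun 'I_t -> int} * {ffun 'I_t -> int} * {ffun 'I_t -> int}) :=
  ([ffun j => to_box M (s.1.1 j)],
   [ffun j => (to_box N (s.1.2 j), to_box N (s.2 j))]) :
  {ffun 'I_t -> box M} * {ffun 'I_t -> box N * box N}.
have solP s : s \in enum_fset (fset_set (solutions k t A B)) ->
    (forall j, [/\ box_int (to_box M (s.1.1 j)) = s.1.1 j,
      box_int (to_box N (s.1.2 j)) = s.1.2 j &
      box_int (to_box N (s.2 j)) = s.2 j]) /\
    \sum_(j < t) s.1.1 j * (s.1.2 j ^+ k - s.2 j ^+ k) = 0.
  move=> sin; have : s \in fset_set (solutions k t A B) by [].
  rewrite in_fset_set; last exact: finite_solutions.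
  move=> /set_mem[H e]; split => // j; have [_ ha hx hy] := H j.
  have le (z : int) (C : R) : 0 <= C -> `|z|%:~R <= C -> (`|z| <= Num.truncn C)%N.
    by move=> C0 zC; rewrite truncn_ge_nat // -abszE in zC *.
  by split; apply: to_boxK; apply: le.
rewrite /U cardE /=.
rewrite -(size_map f); apply: uniq_leq_size.
  rewrite map_inj_in_uniq ?fset_uniq // => -[[a x] y] [[a' x'] y'].
  move=> /solP[/= H _] /solP[/= H' _] [/ffunP ea /ffunP exy].
  congr (_, _, _); apply/ffunP => j; have [h1 h2 h3] := H j; have [h1' h2' h3'] := H' j.
  - by rewrite -h1 -h1'; have := ea j; rewrite !ffunE => ->.
  - by rewrite -h2 -h2'; have := exy j; rewrite !ffunE => -[-> _].
  - by rewrite -h3 -h3'; have := exy j; rewrite !ffunE => -[_ ->].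
move=> _ /mapP[s /solP[H e] ->]; rewrite mem_enum inE /=; apply/eqP; rewrite -[RHS]e.
by apply: eq_bigr => j _; rewrite !ffunE /pow_diff /=; have [-> -> ->] := H j.
Qed.

Lemma divisor_bound_powR (R : realType) (k W : nat) (eps : R) : 0 < eps ->
  exists2 c : R, 0 <= c & forall N : nat, (0 < N)%N ->
    exists2 T : nat,
      (forall m, (0 < m)%N -> (m <= 2 * N ^ k)%N -> (size (divisors m) <= T)%N) &
      T%:R ^+ W <= c * N%:R `^ eps.
Proof.
(* With [m >= k W / eps], the factor [N ^ (k W / m)] in the bound for [T ^ W] is at most
   [N ^ eps]. *)
move=> eps0; pose m := (Num.truncn ((k * W)%:R / eps)).+1.
have mP : (k * W)%:R <= eps * m%:R.
  by rewrite mulrC -ler_pdivrMr // ltW // truncnS_gt.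
have m0 : (0 : R) < m%:R by rewrite ltr0n.
have [K HK] := divisor_bound m.
exists (((2 * K)%:R `^ m%:R^-1) ^+ W); first by rewrite exprn_ge0 // powR_ge0.
move=> N N_gt0; pose y : R := (2 * K * N ^ k)%:R `^ m%:R^-1.
exists (Num.truncn y) => [n n_gt0 nN|].
  rewrite truncn_ge_nat ?powR_ge0 //.
  have -> : (size (divisors n))%:R = ((size (divisors n) ^ m)%:R : R) `^ m%:R^-1.
    by rewrite natrX -powR_mulrn // -powRrM mulfV ?gt_eqF // powRr1.
  apply: ge0_ler_powR; rewrite ?nnegrE ?invr_ge0 ?ler0n //.
  rewrite ler_nat; apply: leq_trans (HK _ n_gt0) _.
  by rewrite [(2 * K)%N]mulnC -mulnA leq_mul2l nN orbT.
apply: le_trans (_ : y ^+ W <= _).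
  by rewrite lerXn2r ?nnegrE ?ler0n ?powR_ge0 // truncn_le // powR_ge0.
rewrite /y natrM powRM ?ler0n // exprMn ler_wpM2l ?exprn_ge0 ?powR_ge0 //.
rewrite natrX -powR_mulrn ?ler0n // -powRrM -powR_mulrn ?powR_ge0 // -powRrM.
apply: ler_powR; first by rewrite ler1n.
by rewrite mulrAC -natrM ler_pdivrMr.
Qed.

Theorem theorem2p5 (R : realType) (k t : nat) (hk : (3 <= k)%N) (ht : (2 <= t)%N)
    (eps : R) (heps : 0 < eps) :
  exists C : R, 0 < C /\
    forall A B : R, 0 < B -> 1 <= 2 * B ^+ k -> 2 * B ^+ k <= A ->
      (U k t A B)%:R <=
        C * ((A * B) ^+ t
             + A ^+ (t - 1) * B `^ (2 * t%:R - k%:R + eps)).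
Proof.
case: t ht => // n _; rewrite subn1 /=.
have k_gt0 : (0 < k)%N by apply: leq_trans hk.
(* The exponent is that of [T] in [box_solutions_le_large]. All constants are fixed before [A] and
   [B]. *)
have [c c0 HT] := divisor_bound_powR k (n * (3 * k).+1).+1 heps.
pose c1 : R := ((18 ^ n.+1 + n.+1 * 27 ^ n.+1))%:R.
pose c2 : R := (n.+1 * 9 * 27 ^ n * 2 ^ (n - k) * 3 ^ n)%:R * c.
have c20 : 0 <= c2 by rewrite mulr_ge0 ?ler0n.
exists (c1 + c2); split.
  by rewrite ltr_wpDr // ltr0n addn_gt0 expn_gt0.
move=> A B B0 hB hA.
have A1 : 1 <= A by apply: le_trans hA.
have A0 : 0 <= A by apply: le_trans A1.
have P10 : 0 <= (A * B) ^+ n.+1 by rewrite exprn_ge0 // mulr_ge0 // ltW.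
have P20 : 0 <= A ^+ n * B `^ (2 * n.+1%:R - k%:R + eps).
  by rewrite mulr_ge0 ?exprn_ge0 ?powR_ge0.
have := @U_le_box R k n.+1 A B A0 (ltW B0).
set M := Num.truncn A; set N := Num.truncn B => leU.
have MA : M%:R <= A by rewrite truncn_le.
have NB : N%:R <= B by rewrite truncn_le // ltW.
have M_gt0 : (0 < M)%N by rewrite truncn_ge_nat.
(* If [B < 1], all [x_j] and [y_j] are [0] and only the coefficients are counted. As
   [1 <= 2 B ^ k <= 2 B], one has [A <= 2 A B], so [(3 A) ^ t <= (6 A B) ^ t]. *)
have [N0|N_gt0] := posnP N.
  have B1 : B < 1.
    by have := truncnS_gt B; rewrite -/N N0.
  have B2 : 1 <= 2 * B.
    apply: le_trans hB _; by rewrite ler_pM2l // ler_iXnr // ltW.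
  have leM : (U k n.+1 A B <= 3 ^ n.+1 * M ^ n.+1)%N.
    apply: leq_trans leU _; rewrite N0 -expnMn; apply: leq_trans (max_card _) _.
    rewrite card_prod !card_ffun card_prod !card_ord mul1n exp1n muln1.
    by apply: leq_expn2r; move: (M) M_gt0; clear; lia.
  apply: le_trans (_ : c1 * (A * B) ^+ n.+1 <= _); last first.
    by rewrite ler_pM ?lerDl ?ler0n // lerDl.
  apply: le_trans (_ : (3 ^ n.+1 * M ^ n.+1)%N%:R <= _); first by rewrite ler_nat.
  apply: le_trans (_ : 6 ^+ n.+1 * (A * B) ^+ n.+1 <= _).
    have AB0 : 0 <= A * B by rewrite mulr_ge0 // ltW.
    have AB2 : A <= 2 * (A * B).
      by rewrite mulrCA -{1}[A]mulr1 ler_wpM2l.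
    rewrite natrM !natrX -!exprMn lerXn2r ?nnegrE ?mulr_ge0 ?ler0n //; lra.
  rewrite ler_wpM2r // /c1 -natrX ler_nat; apply: leq_trans (leq_addr _ _).
  exact: leq_expn2r.
have NM : (2 * N ^ k <= M)%N.
  rewrite truncn_ge_nat // natrM natrX; apply: le_trans hA.
  by rewrite ler_pM2l // lerXn2r ?nnegrE ?ler0n // ltW.
have MNAB : (M * N)%:R ^+ n.+1 <= (A * B) ^+ n.+1.
  rewrite natrM lerXn2r ?nnegrE ?mulr_ge0 ?ler0n ?(ltW B0) //.
  by rewrite ler_pM.
have [kn|nk] := leqP k n; last first.
  have le := leq_trans leU (@box_solutions_le_small k n M N k_gt0 nk N_gt0 NM).
  apply: le_trans (_ : c1 * (A * B) ^+ n.+1 <= _); last first.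
    by rewrite ler_pM ?lerDl ?ler0n // lerDl.
  apply: le_trans (_ : c1 * (M * N)%:R ^+ n.+1 <= _); last by rewrite ler_wpM2l ?ler0n.
  by rewrite /c1 -natrX -natrM ler_nat.
have [T TP TW] := HT N N_gt0.
have le := leq_trans leU (@box_solutions_le_large k n M N T k_gt0 kn N_gt0 NM TP).
set W := (n * (3 * k).+1).+1 in TW le.
rewrite mulrDl; apply: le_trans (_ : c1 * (A * B) ^+ n.+1 +
   c2 * (A ^+ n * B `^ (2 * n.+1%:R - k%:R + eps)) <= _); last first.
  by rewrite lerD // ler_wpM2l ?ler0n // ?lerDl ?lerDr.
move: le; rewrite -(ler_nat R) => /le_trans; apply.
rewrite natrD; apply: lerD.
  rewrite natrM [X in _ * X]natrX; apply: ler_pM; rewrite ?ler0n ?exprn_ge0 ?ler0n //.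
  by rewrite ler_nat leq_addr.
(* Since [k <= n], the natural subtraction in the exponent is not truncated. *)
have -> : B `^ (2 * n.+1%:R - k%:R + eps) = B ^+ (2 * n.+1 - k) * B `^ eps.
  rewrite powRD; last by rewrite (gt_eqF B0) implybT.
  rewrite -powR_mulrn ?(ltW B0) // natrB ?natrM //.
  by move: kn; clear; lia.
rewrite natrM [X in X * _]natrM /c2 -[leLHS]mulrA -[leRHS]mulrA ler_wpM2l ?ler0n //.
rewrite natrM !natrX.
have -> : c * (A ^+ n * (B ^+ (2 * n.+1 - k) * B `^ eps))
  = (c * B `^ eps) * (A ^+ n * B ^+ (2 * n.+1 - k)) by ring.
apply: ler_pM; rewrite ?exprn_ge0 ?mulr_ge0 ?exprn_ge0 ?ler0n //.
  apply: le_trans TW _; rewrite ler_wpM2l // ge0_ler_powR ?nnegrE ?ler0n ?(ltW B0) ?(ltW heps) //.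
by apply: ler_pM; rewrite ?exprn_ge0 ?ler0n // lerXn2r ?nnegrE ?ler0n ?(ltW B0).
Qed.
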